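(* Let $L>0$, $M>0$ and let $N$ satisfy $$0\le N\le \frac{4M}{L^3}\,\sigma(\sqrt M L).$$ Let $p\in L^1[0,L]$ and let $y\in W^{4,1}[0,L]$ be the solution of $$y^{(4)}(x)-My''(x)+N\int_0^L y(t)\,dt=p(x)\ \ \text{a.e. in }(0,L),\qquad y(0)=y(L)=y''(0)=y''(L)=0.$$ If $p\ge 0$ a.e., then $y\ge 0$ and $y''\le 0$ on $[0,L]$. If $p\le 0$ a.e., then $y\le0$ and $y''\ge 0$ on $[0,L]$.
   Context: For $t>0$, $$\sigma(t):=\frac{3t^3}{6t\cosh t+6t-12\sinh t-t^3}.$$ (The denominator is positive for $t>0$.) *)

(* Defs.v *)
From HB Require Import structures.
From mathcomp Require Import all_boot all_order all_algebra.
From mathcomp Require Import all_classical all_reals all_analysis.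
Set Implicit Arguments. Unset Strict Implicit. Unset Printing Implicit Defensive.
Import Order.TTheory GRing.Theory Num.Theory.
Local Open Scope ring_scope.
Local Open Scope classical_set_scope.

Definition coshR {R : realType} (t : R) : R := (expR t + expR (- t)) / 2.
Definition sinhR {R : realType} (t : R) : R := (expR t - expR (- t)) / 2.

Definition sigma {R : realType} (t : R) : R :=
  3 * t ^+ 3 / (6 * t * coshR t + 6 * t - 12 * sinhR t - t ^+ 3).

(* y in W^{4,1}[0,L] with (classical, a.e.) derivatives y1,y2,y3,y4:
   y, y', y'', y''' are absolutely continuous on [0,L], i.e. each is the
   indefinite Lebesgue integral of the next one, and y4 = y'''' is in L^1[0,L]. *)
Definition W41_with {R : realType} (L : R) (y y1 y2 y3 y4 : R -> R) : Prop :=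
  (lebesgue_measure).-integrable `[0, L] (EFin \o y4) /\
  (forall x, 0 <= x <= L ->
     y3 x = y3 0 + Rintegral lebesgue_measure `[0, x] y4) /\
  (forall x, 0 <= x <= L ->
     y2 x = y2 0 + Rintegral lebesgue_measure `[0, x] y3) /\
  (forall x, 0 <= x <= L ->
     y1 x = y1 0 + Rintegral lebesgue_measure `[0, x] y2) /\
  (forall x, 0 <= x <= L ->
     y x = y 0 + Rintegral lebesgue_measure `[0, x] y1).

(* Main.v *)
Require Import Defs.
From HB Require Import structures.
From mathcomp Require Import all_boot all_order all_algebra.
From mathcomp Require Import all_classical all_reals all_analysis.
From mathcomp Require Import ring lra.
Import Order.TTheory GRing.Theory Num.Theory.
Import numFieldNormedType.Exports.
Local Open Scope ring_scope.
Local Open Scope classical_set_scope.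

Set Implicit Arguments.
Unset Strict Implicit.
Unset Printing Implicit Defensive.

(* Put [c = int y], [m = sqrt M], and let [G] be the Dirichlet Green
   function of [-d^2 + M].  With [g = int G(., s) ds] and [psi] the solution of
   [-psi'' + M psi = x (L - x) / 2] vanishing at [0] and [L], one gets
   [c (1 + N int psi) = int psi p] and
     [-(1 + N int psi) y''(x) = int v_x p],
     [v_x(s) = (1 + N int psi) G(x, s) - N g(x) psi(s)].
   The quotient [g(x) psi(s) / G(x, s)] is largest as [(x, s)] tends to the corner
   [(0, L)], where [v_x >= 0] becomes exactly the bound on [N]; then [y'' <= 0],
   and [y] is concave and vanishes at both ends.

   Instead of integrating [v_x p], which would need an integration by parts
   against an absolutely continuous [y'''], only the monotonicity of
   [y''' - M y' + N c x] (a primitive of [p]) is used: it makes the function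
   obtained by formal integration by parts nondecreasing on each side of the kink
   of [v_x] at [s = x]. *)

(** * Derivative rules in pointwise form, applied along the structure of an expression *)

Section pointwise_derivatives.
Context {R : realType}.
Implicit Types (f g : R -> R) (x k df dg : R).

Lemma is_derive_fcst k x : is_derive x 1 (fun _ : R => k) 0.
Proof. exact: is_derive_cst. Qed.

Lemma is_derive_fid x : is_derive x 1 (fun z : R => z) 1.
Proof. exact: is_derive_id. Qed.

Lemma is_derive_fD f g x df dg : is_derive x 1 f df -> is_derive x 1 g dg ->
  is_derive x 1 (fun z => f z + g z) (df + dg).
Proof. exact: is_deriveD. Qed.

Lemma is_derive_fN f x df : is_derive x 1 f df ->
  is_derive x 1 (fun z => - f z) (- df).
Proof. exact: is_deriveN. Qed.

Lemma is_derive_fM f g x df dg : is_derive x 1 f df -> is_derive x 1 g dg ->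
  is_derive x 1 (fun z => f z * g z) (f x * dg + g x * df).
Proof. exact: is_deriveM. Qed.

Lemma is_derive_fX f n x df : is_derive x 1 f df ->
  is_derive x 1 (fun z => f z ^+ n) (n%:R * f x ^+ n.-1 * df).
Proof.
move=> fx; have := is_deriveX n fx.
by congr (is_derive _ _ _ _); apply/funext => z; rewrite fctE.
Qed.

Lemma is_derive_cosh f x df : is_derive x 1 f df ->
  is_derive x 1 (fun z => coshR (f z)) (sinhR (f x) * df).
Proof.
move=> fx; rewrite /coshR /sinhR.
have h1 := is_derive1_comp (is_derive_expR (f x)) fx.
have h2 := @is_derive1_comp R expR (fun z => - f z) x _ _
  (is_derive_expR (- f x)) (is_derive_fN fx).
apply: (is_derive_eq (is_derive_fM (is_derive_fD h1 h2) (is_derive_fcst _ _))).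
ring.
Qed.

Lemma is_derive_sinh f x df : is_derive x 1 f df ->
  is_derive x 1 (fun z => sinhR (f z)) (coshR (f x) * df).
Proof.
move=> fx; rewrite /coshR /sinhR.
have h1 := is_derive1_comp (is_derive_expR (f x)) fx.
have h2 := @is_derive1_comp R expR (fun z => - f z) x _ _
  (is_derive_expR (- f x)) (is_derive_fN fx).
apply: (is_derive_eq (is_derive_fM (is_derive_fD h1 (is_derive_fN h2))
  (is_derive_fcst _ _))).
ring.
Qed.

Lemma is_derive_continuous f x df : is_derive x 1 f df -> {for x, continuous f}.
Proof. by move=> [fx _]; exact/differentiable_continuous/derivable1_diffP. Qed.

End pointwise_derivatives.

(** [derive_tac] lets the rules compute the derivative into an existential variable and leaves its
    equality with the claimed value. Hypotheses come first, for functions such as [y] or [v] known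
    only through their derivative. *)
Ltac derive_step := first
  [ eassumption
  | eapply is_derive_fcst
  | eapply is_derive_fid
  | eapply is_derive_cosh
  | eapply is_derive_sinh
  | eapply is_derive_fX
  | eapply is_derive_fD
  | eapply is_derive_fN
  | eapply is_derive_fM ].
Ltac derive_tac := eapply is_derive_eq; [solve [repeat derive_step]|simpl].

(** * Monotonicity from support functions of zero slope *)

Section nondecreasing_criteria.
Context {R : realType}.

(* The points reached from [c] with mean slope at least [-e] contain their
   supremum, and can be continued past it. *)
Lemma nondecreasing_support (E : R -> R) (a b : R) :
  (forall x : R, x \in `]a, b[%R -> exists2 h : R -> R, is_derive x 1 h 0 &
     forall z, z \in `]a, b[%R -> 0 <= (z - x) * (E z - E x - (h z - h x))) ->
  {in `]a, b[%R &, {homo E : x z / x <= z}}.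
Proof.
move=> supp c d cab dab cd.
(* A slope loss [e] is allowed first and then removed; the divisor [d - c + 1] stays positive when
   [c = d]. *)
suff eps_le (e : R) : 0 < e -> E c <= E d + e * (d - c).
  apply/ler_addgt0Pr => e e0.
  have dc : 0 <= d - c by rewrite subr_ge0.
  have dc1 : 0 < d - c + 1 by lra.
  apply: le_trans (eps_le _ (divr_gt0 e0 dc1)) _.
  rewrite lerD2l mulrAC ler_pdivrMr//; nra.
move=> e0.
have inab x : c <= x <= d -> x \in `]a, b[%R.
  move: cab dab; rewrite !in_itv/= => /andP[? ?] /andP[? ?] /andP[? ?].
  by apply/andP; split; lra.
have loc x : c <= x <= d -> exists2 r : R, 0 < r & forall z, c <= z <= d ->
    `|z - x| < r -> 0 <= (z - x) * (E z - E x + e * (z - x)).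
  move=> /inab xab; have [h hx hE] := supp _ xab.
  (* The slope [g] of [h] is continuous at [x] with value [0] there, so [g > - e] nearby and [e]
     absorbs the contribution of [h]. *)
  have /is_derive1_caratheodory [g [gE gc gx]] := hx.
  have /cvgrPdist_lt /(_ _ e0) := gc.
  rewrite gx => /nbhs_ballP[r /= r0 rg]; exists r => // z zcd zr.
  have {rg}/rg : ball x r z by rewrite -ball_normE/= distrC.
  rewrite /= sub0r normrN ltr_norml => /andP[g1 _].
  have := hE _ (inab _ zcd); rewrite gE.
  have : 0 <= (z - x) ^+ 2 * (g z + e) by rewrite mulr_ge0 ?sqr_ge0//; lra.
  nra.
pose A := [set x | c <= x <= d /\ E c <= E x + e * (x - c)].
have Ac : A c by split; [lra|rewrite subrr mulr0 addr0].
have As : has_sup A by split; [exists c|exists d => x [/andP[]]].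
pose s := sup A.
have sub x : A x -> x <= s by move=> Ax; exact: (ub_le_sup As.2).
have sd : s <= d by apply: ge_sup; [exists c|move=> x [/andP[]]].
have cs : c <= s by exact: sub.
have [|r r0 rE] := loc s; first lra.
(* A point of [A] within [r] to the left of [s] passes its bound on to [s]. *)
have As' : A s.
  have [x xA xs] := sup_adherent r0 As.
  have xs' := sub _ xA; case: xA => xcd xE.
  split; first lra.
  have [xs1|xns] := eqVneq x s; first by rewrite -xs1.
  have xlts : x < s by rewrite lt_neqAle xns.
  have := rE _ xcd; rewrite ler0_norm; last lra.
  have -> : - (x - s) < r by rewrite /s; lra.
  move=> /(_ isT); rewrite nmulr_rge0; last lra.
  lra.
(* If [s < d], the local bound at [s] puts some [z > s] into [A], against the choice of [s]. *)
have [sd1|sned] := eqVneq s d; first by case: As' => _; rewrite sd1.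
have sltd : s < d by rewrite lt_neqAle sned.
pose z := Num.min d (s + r / 2).
have sz : s < z by rewrite lt_min sltd; lra.
have zd : z <= d by rewrite ge_min lexx.
have zr : z <= s + r / 2 by rewrite ge_min lexx orbT.
have zcd : c <= z <= d by lra.
have := rE _ zcd; rewrite ger0_norm; last lra.
have -> : z - s < r by lra.
move=> /(_ isT); rewrite pmulr_rge0 ?subr_gt0// => sE.
suff /sub : A z by rewrite leNgt sz.
by split => //; case: As' => _; lra.
Qed.

(** One-sided limits at [a] and [b] carry monotonicity from the open interval to its ends. *)
Lemma nondecreasing_support_cc (E : R -> R) (a b : R) : a < b ->
  {within `[a, b], continuous E} ->
  (forall x : R, x \in `]a, b[%R -> exists2 h : R -> R, is_derive x 1 h 0 &
     forall z, z \in `]a, b[%R -> 0 <= (z - x) * (E z - E x - (h z - h x))) ->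
  E a <= E b.
Proof.
move=> ab /continuous_within_itvP-/(_ ab)[_ Ea Eb] supp.
have Eoo := nondecreasing_support supp.
pose mid := (a + b) / 2.
have mab : mid \in `]a, b[%R by rewrite in_itv/= /mid; apply/andP; split; lra.
have am : a < mid by rewrite (itvP mab).
have mb : mid < b by rewrite (itvP mab).
apply: (@le_trans _ _ (E mid)).
  rewrite -(cvg_lim _ Ea)//; apply: limr_le; first by apply/cvg_ex; exists (E a).
  near=> z; apply: Eoo => //; last by near: z; exact: nbhs_right_le.
  rewrite in_itv/=; apply/andP; split; near: z; first exact: nbhs_right_gt.
  exact: nbhs_right_lt.
rewrite -(cvg_lim _ Eb)//; apply: limr_ge; first by apply/cvg_ex; exists (E b).
near=> z; apply: Eoo => //; last by near: z; exact: nbhs_left_ge.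
rewrite in_itv/=; apply/andP; split; near: z; last exact: nbhs_left_lt.
exact: nbhs_left_gt.
Unshelve. all: by end_near. Qed.

End nondecreasing_criteria.

(** * Hyperbolic inequalities, by differentiation and comparison at [0] *)

Section hyperbolic_functions.
Context {R : realType}.
Implicit Types (f df : R -> R) (x z t : R).

Lemma ge0_derive_ge0 f df : (forall x, is_derive x 1 f (df x)) ->
  (forall x, 0 < x -> 0 <= df x) -> f 0 = 0 -> forall x, 0 <= x -> 0 <= f x.
Proof.
move=> fdf df0 f0 x; rewrite le_eqVlt => /predU1P[<-|x0]; first by rewrite f0.
have [|c] := MVT x0 (fun z _ => fdf z).
  by apply: continuous_subspaceT => z; exact: is_derive_continuous (fdf z).
rewrite in_itv/= f0 => /andP[c0 _] fE.
have -> : f x = df c * x by rewrite -[LHS]subr0 fE subr0.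
by rewrite mulr_ge0 ?df0// ltW.
Qed.

Lemma gt0_derive_gt0 f df : (forall x, is_derive x 1 f (df x)) ->
  (forall x, 0 < x -> 0 < df x) -> f 0 = 0 -> forall x, 0 < x -> 0 < f x.
Proof.
move=> fdf df0 f0 x x0.
have [|c] := MVT x0 (fun z _ => fdf z).
  by apply: continuous_subspaceT => z; exact: is_derive_continuous (fdf z).
rewrite in_itv/= f0 => /andP[c0 _] fE.
have -> : f x = df c * x by rewrite -[LHS]subr0 fE subr0.
by rewrite mulr_gt0 ?df0.
Qed.

Lemma coshR0 : coshR 0 = 1 :> R.
Proof. by rewrite /coshR oppr0 expR0; field. Qed.

Lemma sinhR0 : sinhR 0 = 0 :> R.
Proof. by rewrite /sinhR oppr0 expR0; field. Qed.

Lemma coshRD x z : coshR (x + z) = coshR x * coshR z + sinhR x * sinhR z.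
Proof. by rewrite /coshR /sinhR opprD !expRD; field. Qed.

Lemma sinhRD x z : sinhR (x + z) = sinhR x * coshR z + coshR x * sinhR z.
Proof. by rewrite /coshR /sinhR opprD !expRD; field. Qed.

Lemma coshR_sqr x : coshR x ^+ 2 = 1 + sinhR x ^+ 2.
Proof.
rewrite /coshR /sinhR expRN; have := expR_gt0 x.
by move=> /lt0r_neq0 ?; field.
Qed.

Lemma coshR_gt0 x : 0 < coshR x.
Proof. by rewrite /coshR divr_gt0// addr_gt0 ?expR_gt0. Qed.

Lemma coshR_ge1 x : 1 <= coshR x.
Proof.
have := coshR_gt0 x; have := coshR_sqr x; have := sqr_ge0 (sinhR x).
nra.
Qed.

Lemma sinhR_gt0 x : 0 < x -> 0 < sinhR x.
Proof.
apply: (@gt0_derive_gt0 (fun z => sinhR z) coshR) => [z|z _|]; last exact: sinhR0.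
- by derive_tac; ring.
- exact: coshR_gt0.
Qed.

Lemma coshR_gt1 x : 0 < x -> 1 < coshR x.
Proof.
move=> /sinhR_gt0 s0; have := coshR_gt0 x; have := coshR_sqr x.
nra.
Qed.

Lemma ge_sinhR x : 0 <= x -> x <= sinhR x.
Proof.
move=> x0; rewrite -subr_ge0.
apply: (@ge0_derive_ge0 (fun z => sinhR z - z) (fun z => coshR z - 1)) => //.
- by move=> z; derive_tac; ring.
- by move=> z _; rewrite subr_ge0 coshR_ge1.
- by rewrite sinhR0 subr0.
Qed.

Lemma lt_sinhR_mul_coshR x : 0 < x -> sinhR x < x * coshR x.
Proof.
move=> x0; rewrite -subr_gt0.
apply: (@gt0_derive_gt0 (fun z => z * coshR z - sinhR z)
  (fun z => z * sinhR z)) => //.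
- by move=> z; derive_tac; ring.
- by move=> z z0; rewrite mulr_gt0// sinhR_gt0.
- by rewrite sinhR0 mul0r subr0.
Qed.

Lemma coshR_le_half_mul_sinhR x : 0 <= x -> coshR x - 1 <= x / 2 * sinhR x.
Proof.
move=> x0; rewrite -subr_ge0.
apply: (@ge0_derive_ge0 (fun z => z / 2 * sinhR z - (coshR z - 1))
  (fun z => (z * coshR z - sinhR z) / 2)) => //.
- by move=> z; derive_tac; field.
- by move=> z /lt_sinhR_mul_coshR; lra.
- by rewrite sinhR0 coshR0; ring.
Qed.

(** This is [tanh (x / 2) < x / 2], since [sinh x / (1 + cosh x) = tanh (x / 2)]. *)
Lemma lt_sinhR_half_mul x : 0 < x -> sinhR x < x / 2 * (1 + coshR x).
Proof.
move=> x0; rewrite -subr_gt0.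
apply: (@gt0_derive_gt0 (fun z => z / 2 * (1 + coshR z) - sinhR z)
  (fun z => z / 2 * sinhR z - (coshR z - 1) / 2)) => //.
- by move=> z; derive_tac; field.
- move=> z z0; have := coshR_le_half_mul_sinhR (ltW z0).
  by have := coshR_gt1 z0; lra.
- by rewrite sinhR0 coshR0; ring.
Qed.

(** The expression and its first derivative vanish at [0], and its second derivative is
    [6 * z * (coshR z - 1)]. *)
Lemma sigma_denominator_gt0 t : 0 < t ->
  0 < 6 * t * coshR t + 6 * t - 12 * sinhR t - t ^+ 3.
Proof.
apply: (@gt0_derive_gt0
  (fun z => 6 * z * coshR z + 6 * z - 12 * sinhR z - z ^+ 3)
  (fun z => 6 * z * sinhR z - 6 * coshR z + 6 - 3 * z ^+ 2)); last first.
- by rewrite sinhR0 coshR0; ring.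
- apply: (@gt0_derive_gt0 _ (fun z => 6 * z * (coshR z - 1))); last first.
  + by rewrite sinhR0 coshR0; ring.
  + by move=> z z0; rewrite !mulr_gt0// subr_gt0 coshR_gt1.
  + by move=> z; derive_tac; ring.
- by move=> z; derive_tac; ring.
Qed.

(* Solution of [e'' = e + z (t - z) / 2] with [e 0 = e' 0 = 0]. *)
Definition ebump t z := t / 2 * sinhR z - z * (t - z) / 2 + 1 - coshR z.

(** Replacing [coshR z - 1] by the larger [z / 2 * sinhR z] leaves [(t - z) / 2 * (sinhR z - z)]. *)
Lemma ebump_ge0 t z : 0 <= z <= t -> 0 <= ebump t z.
Proof.
move=> /andP[z0 zt]; rewrite /ebump.
have := coshR_le_half_mul_sinhR z0; have := ge_sinhR z0.
nra.
Qed.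

End hyperbolic_functions.

(** * Integration by parts against a test function *)

Section test_function.
Context {R : realType}.

Definition primitive_on (L : R) (F f : R -> R) : Prop :=
  {within `[0, L], continuous F} /\
  (forall x : R, 0 < x < L -> is_derive x 1 F (f x)).

Lemma primitive_onN (L : R) (F f : R -> R) : primitive_on L F f ->
  primitive_on L (fun x => - F x) (fun x => - f x).
Proof.
move=> [cF dF]; split => [x|x /dF]; first by apply: cvgN; exact: cF.
exact: is_derive_fN.
Qed.

(* When [v'' = M v + lam x (L - x) / 2], [V' = v] and [Y' = y], this is the
   antiderivative of [v * (y'''' - M y'' + Nc)] obtained by parts. *)
Definition parts_form (L Nc lam : R) (y y1 y2 y3 Y v v1 V : R -> R) (x : R) :=
  v x * y3 x - v1 x * y2 x + Nc * V x +
  lam * (x * (L - x) / 2 * y1 x - (L / 2 - x) * y x - Y x).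

(** Formally the derivative is [v * Q'] with [Q = y3 - M * y1 + Nc * x]; the monotonicity of [Q]
    stands in for [Q' >= 0]. *)
Lemma parts_nondecreasing (L M Nc lam a b : R)
    (y y1 y2 y3 Y v v1 V : R -> R) :
  0 <= a -> a < b -> b <= L ->
  primitive_on L Y y -> primitive_on L y y1 -> primitive_on L y1 y2 ->
  primitive_on L y2 y3 -> {within `[0, L], continuous y3} ->
  (forall x z : R, 0 < x -> x <= z -> z < L ->
    y3 x - M * y1 x + Nc * x <= y3 z - M * y1 z + Nc * z) ->
  (forall x : R, is_derive x 1 v (v1 x)) ->
  (forall x : R, is_derive x 1 v1 (M * v x + lam * (x * (L - x) / 2))) ->
  (forall x : R, is_derive x 1 V (v x)) ->
  (forall x, a < x < b -> 0 <= v x) ->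
  parts_form L Nc lam y y1 y2 y3 Y v v1 V a <=
  parts_form L Nc lam y y1 y2 y3 Y v v1 V b.
Proof.
move=> a0 ab bL [cY dY] [cy dy] [cy1 dy1] [cy2 dy2] cy3 Qle dv dv1 dV v0.
set E := parts_form _ _ _ _ _ _ _ _ _ _ _.
have abL : `[a, b] `<=` `[0, L].
  by move=> x; rewrite /= !in_itv/= => /andP[? ?]; apply/andP; split; lra.
apply: nondecreasing_support_cc => //.
  apply: (continuous_subspaceW abL) => x.
  have ct (f : R -> R) : continuous f -> {within `[0, L], continuous f}.
    exact: continuous_subspaceT.
  have cv : continuous v by move=> z; exact: is_derive_continuous (dv z).
  have cv1 : continuous v1 by move=> z; exact: is_derive_continuous (dv1 z).
  have cV : continuous V by move=> z; exact: is_derive_continuous (dV z).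
  have cp : continuous (fun x : R => x * (L - x) / 2).
    move=> z; eapply is_derive_continuous; derive_tac; reflexivity.
  have cl : continuous (fun x : R => L / 2 - x).
    move=> z; eapply is_derive_continuous; derive_tac; reflexivity.
  rewrite /E /parts_form.
  apply: cvgD; [apply: cvgD; [apply: cvgB; apply: cvgM|apply: cvgM]|apply: cvgM].
  - exact: (ct v cv x).
  - exact: cy3.
  - exact: (ct v1 cv1 x).
  - exact: cy2.
  - exact: cvg_cst.
  - exact: (ct V cV x).
  - exact: cvg_cst.
  - apply: cvgB; last exact: cY.
    apply: cvgB; apply: cvgM.
    + exact: (ct _ cp x).
    + exact: cy1.
    + exact: (ct _ cl x).
    + exact: cy.
move=> x; rewrite in_itv/= => xab.
have xL : 0 < x < L by lra.
pose Q z := y3 z - M * y1 z + Nc * z.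
(* The support function is [E z - v z * (Q z - Q x)], that is, [E] with [Q] frozen at [x]; the
   equation for [v1] makes its derivative at [x] vanish. *)
exists (fun z => Q x * v z + (M * (v z * y1 z) - Nc * (z * v z) - v1 z * y2 z +
    Nc * V z + lam * (z * (L - z) / 2 * y1 z - (L / 2 - z) * y z - Y z))).
  have := dv x; have := dv1 x; have := dV x; have := dY x xL.
  have := dy x xL; have := dy1 x xL; have := dy2 x xL => *.
  by derive_tac; rewrite /Q; field.
move=> z; rewrite in_itv/= => zab.
have -> : E z - E x - (Q x * v z + (M * (v z * y1 z) - Nc * (z * v z) -
    v1 z * y2 z + Nc * V z + lam * (z * (L - z) / 2 * y1 z -
    (L / 2 - z) * y z - Y z)) - (Q x * v x + (M * (v x * y1 x) -
    Nc * (x * v x) - v1 x * y2 x + Nc * V x +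
    lam * (x * (L - x) / 2 * y1 x - (L / 2 - x) * y x - Y x)))) =
    v z * (Q z - Q x) by rewrite /E /parts_form /Q; ring.
have vz := v0 _ zab.
have [xz|zx] := leP x z.
  have : Q x <= Q z by apply: Qle; lra.
  by move=> ?; rewrite !mulr_ge0// subr_ge0.
have : Q z <= Q x by apply: Qle; lra.
by move=> ?; rewrite mulr_le0 ?mulr_ge0_le0// subr_le0// ltW.
Qed.

End test_function.

(** * The two explicit branches of the kernel *)

Section profile.
Context {R : realType}.
Implicit Types (f : R -> R) (x z t al be df : R).

(* Up to the factor [m], the kernel [v_x] is [profile] of [m s] for [s <= x] and
   of [m (L - s)] for [s >= x], with [t = m L]. *)
Definition profile al be t z := al * sinhR z + be * ebump t z.

Definition profile' al be t z :=
  al * coshR z + be * (t / 2 * coshR z - t / 2 + z - sinhR z).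

Definition profileI al be t z := al * (coshR z - 1) +
  be * (t / 2 * (coshR z - 1) - t * z ^+ 2 / 4 + z ^+ 3 / 6 + z - sinhR z).

Lemma is_derive_profile al be t f x df : is_derive x 1 f df ->
  is_derive x 1 (fun s => profile al be t (f s)) (profile' al be t (f x) * df).
Proof. by move=> ?; rewrite /profile /ebump; derive_tac; rewrite /profile'; field. Qed.

Lemma is_derive_profile' al be t f x df : is_derive x 1 f df ->
  is_derive x 1 (fun s => profile' al be t (f s))
    ((profile al be t (f x) + be * (f x * (t - f x) / 2)) * df).
Proof.
by move=> ?; rewrite /profile'; derive_tac; rewrite /profile /ebump; field.
Qed.

Lemma is_derive_profileI al be t f x df : is_derive x 1 f df ->
  is_derive x 1 (fun s => profileI al be t (f s)) (profile al be t (f x) * df).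
Proof.
by move=> ?; rewrite /profileI; derive_tac; rewrite /profile /ebump; field.
Qed.

Lemma profile0 al be t : profile al be t 0 = 0.
Proof. by rewrite /profile /ebump sinhR0 coshR0; field. Qed.

Lemma profileI0 al be t : profileI al be t 0 = 0.
Proof. by rewrite /profileI sinhR0 coshR0; field. Qed.

Lemma profile_ge0 al be t z : 0 <= al -> 0 <= be -> 0 <= z <= t ->
  0 <= profile al be t z.
Proof.
move=> al0 be0 zt; rewrite addr_ge0// mulr_ge0 ?ebump_ge0//.
case/andP: zt => z0 _; exact: le_trans (ge_sinhR z0).
Qed.

End profile.

(** * The kernel in rescaled variables: [th = m x], [et = m (L - x)], [kap = N / m^5] *)

Section kernel_coefficients.
Context {R : realType}.
Variables (kap th et : R).
Hypotheses (kap0 : 0 <= kap) (th0 : 0 < th) (et0 : 0 < et).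
Let t := th + et.
Hypothesis kapD :
  kap * (6 * t * coshR t + 6 * t - 12 * sinhR t - t ^+ 3) <= 12.

(** This is [tanh (z / 2)]; in the rescaled problem [t / 2 - tanh_half t] is the slope of [psi] at
    [0]. *)
Definition tanh_half (z : R) := sinhR z / (1 + coshR z).
(** The factor [1 + N int psi]. *)
Definition kernel_norm := 1 + kap * (t ^+ 3 / 12 - t + 2 * tanh_half t).
(** In the original variables, [M g(x)]. *)
Definition kernel_mass := (sinhR t - sinhR th - sinhR et) / sinhR t.
(** The slope of a branch at its boundary point: the first term comes from [G], the second from the
    slope of [psi]. *)
Definition kernel_coef (z : R) :=
  kernel_norm * sinhR z / sinhR t - kap * kernel_mass * (t / 2 - tanh_half t).

Let St0 : 0 < sinhR t. Proof. by apply: sinhR_gt0; exact: addr_gt0. Qed.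
Let StE : sinhR t = sinhR th * coshR et + coshR th * sinhR et.
Proof. exact: sinhRD. Qed.
Let CtE : coshR t = coshR th * coshR et + sinhR th * sinhR et.
Proof. exact: coshRD. Qed.
Let Ct1 : 0 < 1 + coshR t. Proof. by rewrite addr_gt0 ?coshR_gt0. Qed.
Let TE : tanh_half t * (1 + coshR t) = sinhR t.
Proof. by rewrite /tanh_half divfK// lt0r_neq0. Qed.

(** By the half-sum formulas both sums contain the factor [2 cosh ((th - et) / 2)], and what remains
    has quotient [tanh (t / 2)]. *)
Lemma tanh_half_sum :
  tanh_half t * (coshR th + coshR et) = sinhR th + sinhR et.
Proof.
apply: (mulIf (lt0r_neq0 Ct1)); rewrite mulrAC TE StE CtE.
have e1 : sinhR th * coshR et ^+ 2 = sinhR th * (1 + sinhR et ^+ 2).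
  by rewrite coshR_sqr.
have e2 : sinhR et * coshR th ^+ 2 = sinhR et * (1 + sinhR th ^+ 2).
  by rewrite coshR_sqr.
lra.
Qed.

Lemma tanh_half_diff :
  tanh_half t * (sinhR th - sinhR et) = coshR th - coshR et.
Proof.
apply: (mulIf (lt0r_neq0 Ct1)); rewrite mulrAC TE StE CtE.
have e1 : coshR th * coshR et ^+ 2 = coshR th * (1 + sinhR et ^+ 2).
  by rewrite coshR_sqr.
have e2 : coshR et * coshR th ^+ 2 = coshR et * (1 + sinhR th ^+ 2).
  by rewrite coshR_sqr.
lra.
Qed.

Lemma kernel_mass_ge0 : 0 <= kernel_mass.
Proof.
rewrite divr_ge0 ?(ltW St0)// StE.
have := coshR_ge1 th; have := coshR_ge1 et.
have := sinhR_gt0 th0; have := sinhR_gt0 et0; nra.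
Qed.

Let psi_gt0 : 0 < t / 2 - tanh_half t.
Proof.
rewrite -(pmulr_lgt0 _ Ct1) mulrBl TE subr_gt0.
by apply: lt_sinhR_half_mul; exact: addr_gt0.
Qed.

(** The bound on [N] enters the kernel here: twelve times the difference of the two sides is [12]
    minus the left side of [kapD]. *)
Lemma kernel_norm_ge :
  kap * (t / 2 - tanh_half t) * (coshR t - 1) <= kernel_norm.
Proof. by rewrite /kernel_norm; move: kapD TE; nra. Qed.

Lemma kernel_norm_gt0 : 0 < kernel_norm.
Proof.
have [k0|/eqP k0] := eqVneq kap 0; first by rewrite /kernel_norm k0 mul0r addr0.
apply: lt_le_trans kernel_norm_ge; rewrite !mulr_gt0//.
  by rewrite lt_neqAle eq_sym kap0 andbT; exact/eqP.
by rewrite subr_gt0 coshR_gt1// addr_gt0.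
Qed.

(** The inequality [sup] reduces every [et] to the limit [et -> 0], where the condition is
    [kernel_norm_ge]. *)
Lemma kernel_coef_ge0 : 0 <= kernel_coef et.
Proof.
have Sth := sinhR_gt0 th0; have Set_ := sinhR_gt0 et0.
have Cth := coshR_ge1 th; have Cet := coshR_ge1 et.
have mE : kernel_mass * sinhR t = sinhR t - sinhR th - sinhR et.
  by rewrite divfK// lt0r_neq0.
rewrite -(pmulr_lge0 _ St0).
have -> : kernel_coef et * sinhR t = kernel_norm * sinhR et -
    kap * (t / 2 - tanh_half t) * (sinhR t - sinhR th - sinhR et).
  by rewrite /kernel_coef -mE; field; exact: lt0r_neq0.
have sup : sinhR t - sinhR th - sinhR et <= (coshR t - 1) * sinhR et.
  have e1 : sinhR th * coshR et ^+ 2 = sinhR th * (1 + sinhR et ^+ 2).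
    by rewrite coshR_sqr.
  (* This product is the difference of the two sides of [sup]. *)
  have : 0 <= (coshR et - 1) * (sinhR et * coshR th + sinhR th * coshR et).
    by rewrite mulr_ge0 ?subr_ge0// addr_ge0// mulr_ge0//; lra.
  rewrite StE CtE; lra.
have k0 : 0 <= kap * (t / 2 - tanh_half t) by rewrite mulr_ge0// ltW.
rewrite subr_ge0; apply: le_trans (ler_wpM2l k0 sup) _.
by rewrite mulrA ler_wpM2r ?kernel_norm_ge// ltW.
Qed.

(** Continuity of the kernel at [s = x], where the branches meet. *)
Lemma kernel_match :
  profile (kernel_coef et) (kap * kernel_mass) t th =
  profile (kernel_coef th) (kap * kernel_mass) t et.
Proof.
rewrite /profile /ebump /kernel_coef.
have d : kap * kernel_mass * (tanh_half t * (sinhR th - sinhR et)) =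
  kap * kernel_mass * (coshR th - coshR et) by rewrite tanh_half_diff.
have -> : t - th = et by rewrite /t; ring.
have -> : t - et = th by rewrite /t; ring.
lra.
Qed.

(** The jump of the slope of the kernel at [s = x]; the second branch is reflected, hence the plus
    sign. *)
Lemma kernel_jump :
  profile' (kernel_coef et) (kap * kernel_mass) t th +
  profile' (kernel_coef th) (kap * kernel_mass) t et = kernel_norm.
Proof.
rewrite /profile' /kernel_coef.
have d : kap * kernel_mass * (tanh_half t * (coshR th + coshR et)) =
  kap * kernel_mass * (sinhR th + sinhR et) by rewrite tanh_half_sum.
have k : kernel_norm = kernel_norm / sinhR t *
    (sinhR th * coshR et + coshR th * sinhR et).
  by rewrite -StE divfK// lt0r_neq0.
have tE : kap * kernel_mass * t = kap * kernel_mass * (th + et) by [].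
lra.
Qed.

(** The integral of the kernel: [G] contributes [kernel_norm * kernel_mass], of which the [psi] term
    leaves [kernel_mass]. *)
Lemma kernel_integral :
  profileI (kernel_coef et) (kap * kernel_mass) t th +
  profileI (kernel_coef th) (kap * kernel_mass) t et = kernel_mass.
Proof.
have d : kap * kernel_mass * (tanh_half t * (coshR th + coshR et)) =
  kap * kernel_mass * (sinhR th + sinhR et) by rewrite tanh_half_sum.
have mE : kernel_norm * kernel_mass = kernel_norm / sinhR t *
    (sinhR th * coshR et + coshR th * sinhR et - sinhR th - sinhR et).
  by rewrite -StE /kernel_mass; ring.
have kE : kernel_norm * kernel_mass = kernel_mass +
    kap * kernel_mass * (t ^+ 3 / 12 - t + 2 * tanh_half t).
  by rewrite {1}/kernel_norm; ring.
have p : kap * kernel_mass * (t ^+ 3 / 12 - t) = kap * kernel_mass *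
    (t * (th ^+ 2 + et ^+ 2) / 4 - (th ^+ 3 + et ^+ 3) / 6 - (th + et)).
  by congr (_ * _); rewrite /t; field.
rewrite /profileI /kernel_coef.
lra.
Qed.

End kernel_coefficients.

(** * Signs of [y''] and [y] *)

Section sign_of_solution.
Context {R : realType}.

(** The inequalities on [[0, x]] and [[x, L]] are combined: [y3 x] cancels by continuity of the
    kernel, the terms in [c] by its integral, and the slope jump times [- y2 x] remains. *)
Lemma second_derivative_le0 (L M N c : R) (Y y y1 y2 y3 : R -> R) :
  0 < L -> 0 < M -> 0 <= N -> N <= 4 * M / L ^+ 3 * sigma (Num.sqrt M * L) ->
  primitive_on L Y y -> primitive_on L y y1 -> primitive_on L y1 y2 ->
  primitive_on L y2 y3 -> {within `[0, L], continuous y3} ->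
  (forall x z : R, 0 < x -> x <= z -> z < L ->
    y3 x - M * y1 x + N * c * x <= y3 z - M * y1 z + N * c * z) ->
  Y 0 = 0 -> Y L = c -> y 0 = 0 -> y L = 0 -> y2 0 = 0 -> y2 L = 0 ->
  forall x, 0 < x < L -> y2 x <= 0.
Proof.
move=> L0 M0 N0 NL pY py py1 py2 cy3 Qle Y0 YL y00 yL y20 y2L x /andP[x0 xL].
pose m := Num.sqrt M.
have m0 : 0 < m by rewrite sqrtr_gt0.
have ME : M = m ^+ 2 by rewrite sqr_sqrtr// ltW.
pose th := m * x; pose et := m * (L - x); pose kap := N / m ^+ 5.
have th0 : 0 < th by rewrite mulr_gt0.
have et0 : 0 < et by rewrite mulr_gt0// subr_gt0.
have tE : th + et = m * L by rewrite /th /et; ring.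
have kap0 : 0 <= kap by rewrite divr_ge0// exprn_ge0// ltW.
have mL0 : 0 < m * L by rewrite mulr_gt0.
have kapD : kap * (6 * (th + et) * coshR (th + et) + 6 * (th + et) -
    12 * sinhR (th + et) - (th + et) ^+ 3) <= 12.
  (* With [D] the denominator of [sigma], the bound on [N] reads [N * D <= 12 * m ^+ 5]. *)
  rewrite tE; move: NL; rewrite /sigma -/m.
  have := sigma_denominator_gt0 mL0.
  set D := (X in 0 < X) => D0.
  rewrite (_ : 4 * M / L ^+ 3 * (3 * (m * L) ^+ 3 / D) = 12 * m ^+ 5 / D); last first.
    by rewrite ME; field; rewrite !lt0r_neq0.
  rewrite ler_pdivlMr// => ND.
  by rewrite /kap mulrAC ler_pdivrMr// exprn_gt0.
(* Two factors [m] come from rescaling [s * (L - s)], two from differentiating twice. *)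
pose be := kap * kernel_mass th et; pose lam := be * m ^+ 4.
pose al1 := kernel_coef kap th et et; pose al2 := kernel_coef kap th et th.
have be0 : 0 <= be by rewrite mulr_ge0// kernel_mass_ge0.
have al10 : 0 <= al1 by exact: kernel_coef_ge0.
have al20 : 0 <= al2.
  (* The reflection [x -> L - x] swaps [th] and [et], preserving their sum and [kernel_mass]. *)
  rewrite /al2; have := @kernel_coef_ge0 R kap et th kap0 et0 th0.
  rewrite /kernel_coef /kernel_norm /kernel_mass (addrC et th).
  by rewrite [_ - sinhR et - _]addrAC; apply.
have dl (s : R) : is_derive s 1 (fun s : R => m * s) m by derive_tac; ring.
have dr (s : R) : is_derive s 1 (fun s : R => m * (L - s)) (- m).
  by derive_tac; ring.
pose t := m * L.
pose v s := profile al1 be t (m * s); pose v1 s := m * profile' al1 be t (m * s).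
pose V s := profileI al1 be t (m * s) / m.
pose w s := profile al2 be t (m * (L - s)).
pose w1 s := - m * profile' al2 be t (m * (L - s)).
pose W s := - profileI al2 be t (m * (L - s)) / m.
have m_neq0 : m != 0 by rewrite lt0r_neq0.
have dv (s : R) : is_derive s 1 v (v1 s).
  apply: (is_derive_eq (is_derive_profile al1 be t (dl s))).
  by rewrite mulrC.
have dv1 (s : R) : is_derive s 1 v1 (M * v s + lam * (s * (L - s) / 2)).
  have d := is_derive_profile' al1 be t (dl s).
  apply: (is_derive_eq (is_derive_fM (is_derive_fcst m s) d)).
  by rewrite /lam ME /t /v; field.
have dV (s : R) : is_derive s 1 V (v s).
  have d := is_derive_profileI al1 be t (dl s).
  apply: (is_derive_eq (is_derive_fM d (is_derive_fcst m^-1 s))).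
  by rewrite /v; field.
have dw (s : R) : is_derive s 1 w (w1 s).
  apply: (is_derive_eq (is_derive_profile al2 be t (dr s))).
  by rewrite mulrC.
have dw1 (s : R) : is_derive s 1 w1 (M * w s + lam * (s * (L - s) / 2)).
  have d := is_derive_profile' al2 be t (dr s).
  apply: (is_derive_eq (is_derive_fM (is_derive_fcst (- m) s) d)).
  by rewrite /lam ME /t /w; field.
have dW (s : R) : is_derive s 1 W (w s).
  have d := is_derive_fN (is_derive_profileI al2 be t (dr s)).
  apply: (is_derive_eq (is_derive_fM d (is_derive_fcst m^-1 s))).
  by rewrite /w; field.
have v0 s : 0 < s < x -> 0 <= v s.
  move=> /andP[s0 sx]; apply: profile_ge0 => //.
  by rewrite mulr_ge0 ?ler_pM2l ?ltW//; lra.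
have w0 s : x < s < L -> 0 <= w s.
  move=> /andP[s0 sx]; apply: profile_ge0 => //.
  by rewrite mulr_ge0 ?ler_pM2l ?ltW//; lra.
have left := parts_nondecreasing (lexx 0) x0 (ltW xL) pY py py1 py2 cy3 Qle
  dv dv1 dV v0.
have right := parts_nondecreasing (ltW x0) xL (lexx L) pY py py1 py2 cy3 Qle
  dw dw1 dW w0.
have vw : v x = w x by rewrite /v /w /t -tE; exact: kernel_match.
have v1w1 : v1 x - w1 x = m * kernel_norm kap th et.
  rewrite -(kernel_jump kap th0 et0) /v1 /w1 /t -tE; ring.
have VW : V x - W x = kernel_mass th et / m.
  rewrite -(kernel_integral kap) /V /W /t -tE; field.
  by [].
(* The nonlocal term integrated against the kernel balances [lam * Y L], the only boundary term that
   survives. *)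
have lamE : N * c * (kernel_mass th et / m) = lam * c.
  by rewrite /lam /be /kap; field.
move: left right; rewrite /parts_form /v /V /w /W mulr0 subrr mulr0.
rewrite !profile0 !profileI0 -/(v x) -/(w x) -/(V x) -/(W x).
rewrite Y0 YL y00 yL y20 y2L -vw => left right.
have : 0 <= m * kernel_norm kap th et * - y2 x.
  have := lamE; rewrite -VW -v1w1; lra.
by rewrite pmulr_rge0 ?oppr_ge0// mulr_gt0// kernel_norm_gt0.
Qed.

(** A negative value at [x] forces a negative slope before [x] and a positive one after it, hence
    [y2 > 0] somewhere between. *)
Lemma concave_ge0 (L : R) (y y1 y2 : R -> R) : 0 < L ->
  primitive_on L y y1 -> primitive_on L y1 y2 -> y 0 = 0 -> y L = 0 ->
  (forall x, 0 < x < L -> y2 x <= 0) -> forall x, 0 < x < L -> 0 <= y x.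
Proof.
move=> L0 [cy dy] [cy1 dy1] y0 yL y2le x /andP[x0 xL].
have sub (a b : R) : 0 <= a -> b <= L -> `[a, b] `<=` `[0, L].
  by move=> a0 bL z; rewrite /= !in_itv/= => /andP[? ?]; apply/andP; split; lra.
rewrite leNgt; apply/negP => yx.
have [||a] := @MVT R y y1 0 x x0.
- by move=> z; rewrite in_itv/= => ?; apply: dy; lra.
- by apply: continuous_subspaceW cy; apply: sub => //; exact: ltW.
rewrite in_itv/= y0 !subr0 => /andP[a0 ax] yxE.
have [||b] := @MVT R y y1 x L xL.
- by move=> z; rewrite in_itv/= => ?; apply: dy; lra.
- by apply: continuous_subspaceW cy; apply: sub => //; exact: ltW.
rewrite in_itv/= yL sub0r => /andP[xb bL] yxE'.
have ab : a < b by lra.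
have [||d] := @MVT R y1 y2 a b ab.
- by move=> z; rewrite in_itv/= => ?; apply: dy1; lra.
- by apply: continuous_subspaceW cy1; apply: sub; lra.
rewrite in_itv/= => /andP[ad db] y1E.
have := y2le d; have -> : 0 < d < L by lra.
move=> /(_ isT) y2d.
have y1a : y1 a < 0 by rewrite -(pmulr_llt0 _ x0) -yxE.
have y1b : 0 < y1 b.
  have Lx : 0 < L - x by lra.
  by rewrite -(pmulr_lgt0 _ Lx) -yxE'; lra.
have : y2 d * (b - a) <= 0 by rewrite mulr_le0_ge0//; lra.
lra.
Qed.

(** The sign of [p] is encoded in the monotonicity of its primitive, so the same statement serves
    [y] and [- y]. *)
Lemma solution_sign (L M N c : R) (Y y y1 y2 y3 : R -> R) :
  0 < L -> 0 < M -> 0 <= N -> N <= 4 * M / L ^+ 3 * sigma (Num.sqrt M * L) ->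
  primitive_on L Y y -> primitive_on L y y1 -> primitive_on L y1 y2 ->
  primitive_on L y2 y3 -> {within `[0, L], continuous y3} ->
  (forall x z : R, 0 < x -> x <= z -> z < L ->
    y3 x - M * y1 x + N * c * x <= y3 z - M * y1 z + N * c * z) ->
  Y 0 = 0 -> Y L = c -> y 0 = 0 -> y L = 0 -> y2 0 = 0 -> y2 L = 0 ->
  forall x, 0 <= x <= L -> 0 <= y x /\ y2 x <= 0.
Proof.
move=> L0 M0 N0 NL pY py py1 py2 cy3 Qle Y0 YL y00 yL y20 y2L x.
have y2le := second_derivative_le0 L0 M0 N0 NL pY py py1 py2 cy3 Qle
  Y0 YL y00 yL y20 y2L.
move=> /andP[]; rewrite le_eqVlt => /predU1P[<- _|x0].
  by rewrite y00 y20.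
rewrite le_eqVlt => /predU1P[->|xL]; first by rewrite yL y2L.
have x0L : 0 < x < L by rewrite x0.
by split; [exact: (concave_ge0 L0 py py1)|exact: y2le].
Qed.

End sign_of_solution.

(** * From indefinite Lebesgue integrals to pointwise derivatives and increments *)

Section indefinite_integrals.
Context {R : realType}.
Local Notation mu := (@lebesgue_measure R).
Implicit Types (f g F : R -> R) (L : R).

Lemma indefinite_continuous L F f : 0 < L ->
  mu.-integrable `[0, L] (EFin \o f) ->
  (forall x, 0 <= x <= L -> F x = F 0 + Rintegral mu `[0, x] f) ->
  {within `[0, L], continuous F}.
Proof.
move=> L0 fi FE.
have FE' : {in `[0, L], (fun x => F 0 + Rintegral mu `[0, x] f) =1 F}.
  by move=> x; rewrite inE/= in_itv/= => /FE ->.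
apply: (subspace_eq_continuous FE') => x; apply: cvgD; first exact: cvg_cst.
exact: (parameterized_integral_continuous (ltW L0) fi).
Qed.

Lemma continuous_integrable L f : {within `[0, L], continuous f} ->
  mu.-integrable `[0, L] (EFin \o f).
Proof.
by move=> cf; apply: continuous_compact_integrable => //; exact: segment_compact.
Qed.

Lemma indefinite_primitive L F f : 0 < L -> {within `[0, L], continuous f} ->
  (forall x, 0 <= x <= L -> F x = F 0 + Rintegral mu `[0, x] f) ->
  primitive_on L F f.
Proof.
move=> L0 cf FE; have fi := continuous_integrable cf.
split; first exact: indefinite_continuous FE.
move=> x /andP[x0 xL].
have [fx _ _] := (continuous_within_itvP _ L0).1 cf.
have xoo : x \in `]0, L[%R by rewrite in_itv/= x0.
have [dI dIE] := continuous_FTC1_closed xL fi x0 (fx _ xoo).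
have dI' : is_derive x 1 (fun x => Rintegral mu `[0, x] f) (f x).
  by split => //; rewrite -derive1E.
have := is_derive_fD (is_derive_fcst (F 0) x) dI'.
(* The integral formula for [F] is given on [[0, L]], hence the transfer near an interior point. *)
rewrite add0r => dG; apply: near_eq_is_derive dG.
near=> z; rewrite -FE//.
have : z \in `]0, L[%R by near: z; exact: near_in_itvoo.
by rewrite in_itv/= => /andP[? ?]; apply/andP; split; exact: ltW.
Unshelve. all: by end_near. Qed.

Lemma indefinite_increment L F f x z : 0 < x -> x <= z -> z < L ->
  mu.-integrable `[0, L] (EFin \o f) ->
  (forall x, 0 <= x <= L -> F x = F 0 + Rintegral mu `[0, x] f) ->
  F z - F x = Rintegral mu `]x, z] f.
Proof.
move=> x0 xz zL fi FE; rewrite FE ?(FE x); [|lra..].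
rewrite opprD addrACA subrr add0r Rintegral_itvB ?bnd_simp// ?ltW//.
by apply: integrableS fi => //; apply: subset_itvl; rewrite bnd_simp ltW.
Qed.

Lemma ae_ge0_Rintegral_ge0 (D : set R) f : measurable D ->
  mu.-integrable D (EFin \o f) -> {ae mu, forall x, D x -> 0 <= f x} ->
  0 <= Rintegral mu D f.
Proof.
move=> mD fi [Z [mZ muZ fZ]].
(* Off the null set [Z] the integrand is nonnegative at every point. *)
rewrite /Rintegral (negligible_integral mZ mD fi muZ).
apply: fine_ge0; apply: integral_ge0 => x [Dx nZx]; rewrite lee_fin.
by apply: contrapT => nf; apply: nZx; apply: fZ => /= h; exact/nf/h.
Qed.

(** Integrating the a.e. equation shows that [y3 - M * y1 + k * x] is a primitive of [p]; [k] will
    be [N int y]. *)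
Lemma W41_residual_increment L M k (p y y1 y2 y3 y4 : R -> R) : 0 < L ->
  mu.-integrable `[0, L] (EFin \o p) -> W41_with L y y1 y2 y3 y4 ->
  {ae mu, forall x : R, x \in `]0, L[ -> y4 x - M * y2 x + k = p x} ->
  forall x z, 0 < x -> x <= z -> z < L ->
  (y3 z - M * y1 z + k * z) - (y3 x - M * y1 x + k * x) =
  Rintegral mu `]x, z] p.
Proof.
move=> L0 pi [y4i [y3E [y2E [y1E yE]]]] eqn x z x0 xz zL.
have cy3 := indefinite_continuous L0 y4i y3E.
have cy2 := indefinite_continuous L0 (continuous_integrable cy3) y2E.
have y2i := continuous_integrable cy2.
have sub : `]x, z] `<=` `[0, L].
  by move=> s; rewrite /= !in_itv/= => /andP[? ?]; apply/andP; split; lra.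
have iS f : mu.-integrable `[0, L] (EFin \o f) ->
    mu.-integrable `]x, z] (EFin \o f) by exact: integrableS.
have ki : mu.-integrable `[0, L] (EFin \o (fun=> k)).
  by apply: continuous_integrable => s; exact: cvg_cst.
have My2i : mu.-integrable `[0, L] (EFin \o (fun s => M * y2 s)).
  by apply: continuous_integrable => s; apply: cvgM; [exact: cvg_cst|exact: cy2].
have di : mu.-integrable `[0, L] (EFin \o (fun s => y4 s - M * y2 s)).
  exact: (integrableB _ y4i My2i).
have si : mu.-integrable `[0, L] (EFin \o (fun s => y4 s - M * y2 s + k)).
  exact: (integrableD _ di ki).
have <- : Rintegral mu `]x, z] (fun s => y4 s - M * y2 s + k) =
    Rintegral mu `]x, z] p.
  congr fine; apply: ae_eq_integral => //.
  - by have /measurable_int := iS _ si.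
  - by have /measurable_int := iS _ pi.
  - apply: (@filterS _ _ (ae_filter_ringOfSetsType mu) _ _ _ eqn) => s eqs /=.
    rewrite in_itv/= => /andP[xs sz].
    by congr EFin; apply: eqs; rewrite inE/= in_itv/=; apply/andP; split; lra.
rewrite RintegralD ?RintegralB ?RintegralZl//; try exact: iS.
rewrite -(indefinite_increment x0 xz zL y4i y3E).
rewrite -(indefinite_increment x0 xz zL y2i y1E).
rewrite Rintegral_cst//= lebesgue_measure_itv/= lte_fin.
(* The length of []x, z]] is given by cases; the second one is [z = x]. *)
case: ltP => [_|zx]; first by rewrite -EFinD/=; ring.
have -> : z = x by apply/le_anti; rewrite zx xz.
by rewrite /=; ring.
Qed.

End indefinite_integrals.

(** * Both signs of [p], from the sign result for [y] and for [- y] *)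

Unset Implicit Arguments.

Theorem theorem3p1 (R : realType) (L M N : R) (p y y1 y2 y3 y4 : R -> R) :
  0 < L -> 0 < M ->
  0 <= N -> N <= 4 * M / L ^+ 3 * sigma (Num.sqrt M * L) ->
  (lebesgue_measure).-integrable `[0, L] (EFin \o p) ->
  W41_with L y y1 y2 y3 y4 ->
  {ae lebesgue_measure, forall x : R, x \in `]0, L[ ->
     y4 x - M * y2 x + N * Rintegral lebesgue_measure `[0, L] y = p x} ->
  y 0 = 0 -> y L = 0 -> y2 0 = 0 -> y2 L = 0 ->
  ({ae lebesgue_measure, forall x : R, x \in `]0, L[ -> 0 <= p x} ->
     forall x, 0 <= x <= L -> 0 <= y x /\ y2 x <= 0) /\
  ({ae lebesgue_measure, forall x : R, x \in `]0, L[ -> p x <= 0} ->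
     forall x, 0 <= x <= L -> y x <= 0 /\ 0 <= y2 x).
Proof.
move=> L0 M0 N0 NL pi W eqn y00 yL y20 y2L.
have incr := W41_residual_increment L0 pi W eqn.
case: W => y4i [y3E [y2E [y1E yE]]].
have cy3 := indefinite_continuous L0 y4i y3E.
have py2 := indefinite_primitive L0 cy3 y2E.
have py1 := indefinite_primitive L0 py2.1 y1E.
have py := indefinite_primitive L0 py1.1 yE.
(* The nonlocal quantity becomes the boundary value [Y L]. *)
pose Y x := Rintegral lebesgue_measure `[0, x] y.
have Y0 : Y 0 = 0 by rewrite /Y set_itv1 Rintegral_set1.
have pY : primitive_on L Y y.
  by apply: (indefinite_primitive L0 py.1) => x _; rewrite Y0 add0r.
have subxz x z : 0 < x -> z < L -> `]x, z] `<=` `]0, L[.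
  move=> x0 zL s; rewrite /= !in_itv/= => /andP[? ?].
  by apply/andP; split; lra.
have pixz x z : 0 < x -> z < L ->
    lebesgue_measure.-integrable `]x, z] (EFin \o p).
  move=> x0 zL; apply: integrableS pi => //.
  by apply: subset_trans (subxz _ _ x0 zL) _; exact: subset_itv_oo_cc.
split=> psgn.
  apply: (solution_sign L0 M0 N0 NL pY py py1 py2 cy3) => // x z x0 xz zL.
  rewrite -subr_ge0 incr//; apply: ae_ge0_Rintegral_ge0 => //; first exact: pixz.
  apply: (@filterS _ _ (ae_filter_ringOfSetsType _) _ _ _ psgn) => s ps sxz.
  by apply: ps; rewrite inE; exact: subxz sxz.
(* For [p <= 0] all functions are negated, so [c] becomes [- Y L]. *)
have Qge x z : 0 < x -> x <= z -> z < L ->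
    - y3 x - M * - y1 x + N * - Y L * x <= - y3 z - M * - y1 z + N * - Y L * z.
  move=> x0 xz zL.
  have : 0 <= Rintegral lebesgue_measure `]x, z] (fun s => -1 * p s).
    apply: ae_ge0_Rintegral_ge0 => //.
      exact: (integrableZl _ (-1) (pixz _ _ x0 zL)).
    apply: (@filterS _ _ (ae_filter_ringOfSetsType _) _ _ _ psgn) => s ps sxz.
    by rewrite mulN1r oppr_ge0; apply: ps; rewrite inE; exact: subxz sxz.
  by rewrite RintegralZl// -?incr// -/(Y L); [lra|exact: pixz].
have cNy3 : {within `[0, L], continuous (fun x => - y3 x)}.
  by move=> x; apply: cvgN; exact: cy3.
move=> x xL.
have [] := solution_sign L0 M0 N0 NL (primitive_onN pY) (primitive_onN py)
  (primitive_onN py1) (primitive_onN py2) cNy3 Qge _ erefl _ _ _ _ xL;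
  rewrite ?Y0 ?y00 ?yL ?y20 ?y2L ?oppr0//.
by rewrite oppr_ge0 oppr_le0.
Qed.
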